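(* Let $H=\mathbb Z\left[x,\frac1x\right]$ be the additive group of the Laurent polynomial ring over $\mathbb Z$, and let $G=H\rtimes\mathbb Z$ with $\mathbb Z=\langle t\rangle$ acting on $H$ by $t\,p(x)\,t^{-1}=\alpha(p(x))=x\,p(x)$. Let $S=\{\pm1,\pm x,\pm x^2,\dots\}\subseteq H$. For each positive integer $i$ define $Q^i_0=S$, $Q^i_{r+1}=Q^i_r\cup\alpha^i(Q^i_r+Q^i_r)$ for $r\ge 0$, and $Q^i=\bigcup_{r\ge0}Q^i_r$. Then $[Q^i\cup\{t^{\pm1}\}]\ne[Q^j\cup\{t^{\pm1}\}]$ for all $i<j$. Moreover, $[Q^i\cup\{t^{\pm1}\}]\in\mathcal H_{qp}(H\rtimes\mathbb Z)$ for each $i$.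
   Context: For a group $G$ and a (possibly infinite) generating set $S$, let $\Gamma(G,S)$ be the Cayley graph and $\|\cdot\|_S$ the word norm. For generating sets $S,T$ of $G$ write $T\preceq S$ if $\sup_{g\in S}\|g\|_T<\infty$; put $S\sim T$ if $S\preceq T$ and $T\preceq S$, and let $[S]$ be the equivalence class of $S$. $\mathcal H(G)=\{[S]\mid G=\langle S\rangle,\ \Gamma(G,S)\text{ is (Gromov) hyperbolic}\}$. An isometry $g$ of a hyperbolic space $X$ is loxodromic if $m\mapsto g^m x_0$ is a quasi-isometric embedding $\mathbb Z\to X$ for some (equivalently any) $x_0\in X$. An action of $G$ on a hyperbolic space $X$ is quasi-parabolic if $G$ fixes a unique point of $\partial X$ and at least one element of $G$ acts as a loxodromic isometry. $\mathcal H_{qp}(G)$ is the set of $[S]\in\mathcal H(G)$ such that $G\curvearrowright\Gamma(G,S)$ is quasi-parabolic. *)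

(* Defs.v *)
From HB Require Import structures.
From mathcomp Require Import all_boot all_order all_algebra.
From mathcomp Require Import boolp classical_sets reals.

Set Implicit Arguments.
Unset Strict Implicit.
Unset Printing Implicit Defensive.

Import Order.TTheory GRing.Theory Num.Theory.

Local Open Scope classical_set_scope.
Local Open Scope ring_scope.

Section CoarseGeometry.
Variables (R : realType) (X : Type) (d : X -> X -> R).

Definition gromov_product (o x y : X) : R := (d x o + d y o - d x y) / 2.

Definition gromov_hyperbolic : Prop :=
  exists delta : R, forall o x y z : X,
    Num.min (gromov_product o x y) (gromov_product o y z) - delta
      <= gromov_product o x z.

(* [(u_m | v_n)_o --> +oo] as [m, n --> oo]; for a metric [d] this does not
   depend on [o]. *)
Definition product_diverges (u v : nat -> X) : Prop :=
  forall (o : X) (A : R), exists N : nat, forall m n : nat,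
    (N <= m)%N -> (N <= n)%N -> A <= gromov_product o (u m) (v n).

Definition converges_at_infinity (u : nat -> X) : Prop := product_diverges u u.

(* The sequential boundary: a boundary point is the set of all sequences
   converging at infinity that are equivalent to a given one. *)
Definition gromov_boundary : set (set (nat -> X)) :=
  [set xi | exists u, converges_at_infinity u /\
     xi = [set v | converges_at_infinity v /\ product_diverges u v]].

End CoarseGeometry.

Definition quasi_isometric_embedding (R : realType) (X Y : Type)
    (dX : X -> X -> R) (dY : Y -> Y -> R) (f : X -> Y) : Prop :=
  exists K C : R, [/\ 1 <= K, 0 <= C &
    forall x x' : X, dX x x' / K - C <= dY (f x) (f x') <= K * dX x x' + C].

Definition int_dist (R : realType) (m n : int) : R := `|(m - n)%:~R|.

Definition expgz (G : groupType) (g : G) (m : int) : G :=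
  match m with Posz n => (g ^+ n)%g | Negz n => (g ^- n.+1)%g end.

Section Actions.
Variables (R : realType) (G : groupType) (X : Type) (d : X -> X -> R).
Variable act : G -> X -> X.

Definition loxodromic (g : G) : Prop :=
  exists x0 : X, quasi_isometric_embedding (@int_dist R) d
    (fun m : int => act (expgz g m) x0).

Definition boundary_act (g : G) (xi : set (nat -> X)) : set (nat -> X) :=
  [set (fun n => act g (u n)) | u in xi].

Definition quasi_parabolic : Prop :=
  (exists! xi : set (nat -> X),
     gromov_boundary d xi /\ forall g : G, boundary_act g xi = xi) /\
  (exists g : G, loxodromic g).

End Actions.

Section GeneratingSets.
Variable G : groupType.
Implicit Types (S T : set G) (g h : G).

Definition is_word S g (n : nat) : Prop :=
  exists w : seq G, [/\ size w = n,
    forall s, s \in w -> S s \/ S (s^-1)%g & g = (\prod_(s <- w) s)%g].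

Definition generates S : Prop := forall g, exists n, is_word S g n.

(* The value is 0 by convention when [g] is not in the subgroup generated
   by [S]; it is only used for generating sets. *)
Definition word_norm S g : nat :=
  if pselect (exists n, `[< is_word S g n >]) is left e then ex_minn e else 0.

Definition gen_le T S : Prop :=
  exists C : nat, forall g, S g -> (word_norm T g <= C)%N.

Definition gen_equiv S T : Prop :=
  [/\ generates S, generates T, gen_le S T & gen_le T S].

Definition gen_class S : set (set G) := [set T | gen_equiv S T].

(* The Cayley graph is treated as the metric space formed by its vertex set
   with the graph metric. *)
Definition cayley_dist (R : realType) S g h : R :=
  (word_norm S (g^-1 * h)%g)%:R.

Definition hyperbolic_structures (R : realType) : set (set (set G)) :=
  [set c | exists S, [/\ generates S, gromov_hyperbolic (cayley_dist R S) &
     c = gen_class S]].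

Definition qp_structures (R : realType) : set (set (set G)) :=
  [set c | hyperbolic_structures R c /\
     exists S, [/\ generates S, c = gen_class S &
       quasi_parabolic (cayley_dist R S) (fun g x => (g * x)%g)]].

End GeneratingSets.

(* Z[x, 1/x] as the subring of Z(x) of the fractions p / x^n. *)
Definition fracX : {fraction {poly int}} := tofrac 'X.

Definition is_laurent : pred {fraction {poly int}} :=
  fun f => `[< exists (p : {poly int}) (n : nat), f = tofrac p / fracX ^+ n >].

Lemma fracX_neq0 : fracX != 0.
Proof. by rewrite tofrac_eq0 polyX_eq0. Qed.

Lemma is_laurent_subring : subring_closed is_laurent.
Proof.
split=> [|_ _ /asboolP[p [m ->]] /asboolP[q [n ->]]|
         _ _ /asboolP[p [m ->]] /asboolP[q [n ->]]]; apply/asboolP.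
- by exists 1, 0; rewrite tofrac1 expr0 divr1.
- exists (p * 'X^n - q * 'X^m), (m + n)%N.
  rewrite tofracB !tofracM !tofracXn -/fracX exprD -mulNr addf_div.
  + by rewrite mulNr.
  + by rewrite expf_neq0 ?fracX_neq0.
  + by rewrite expf_neq0 ?fracX_neq0.
- by exists (p * q), (m + n)%N; rewrite tofracM exprD mulf_div.
Qed.

HB.instance Definition _ :=
  GRing.isSubringClosed.Build {fraction {poly int}} is_laurent
    is_laurent_subring.

Record laurent : Type := Laurent {
  laurent_val :> {fraction {poly int}};
  laurent_valP : is_laurent laurent_val }.

HB.instance Definition _ := [isSub for laurent_val].
HB.instance Definition _ := [Choice of laurent by <:].
HB.instance Definition _ := [SubChoice_isSubComNzRing of laurent by <:].

Lemma is_laurent_Xz (m : int) : is_laurent (fracX ^ m).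
Proof.
case: m => n; apply/asboolP.
- by exists 'X^n, 0; rewrite tofracXn expr0 divr1.
- by exists 1, n.+1; rewrite tofrac1 div1r.
Qed.

Definition laurentXz (m : int) : laurent := Laurent (is_laurent_Xz m).

Lemma laurentXz0 : laurentXz 0 = 1.
Proof. exact: val_inj. Qed.

Lemma laurentXzD m n : laurentXz (m + n) = laurentXz m * laurentXz n.
Proof. by apply: val_inj; rewrite /= expfzDr ?fracX_neq0. Qed.

Definition alpha (p : laurent) : laurent := laurentXz 1 * p.

(* [SemiDirect p m] stands for [p t^m]. *)
Record semidirect : Type := SemiDirect {
  sd_base : laurent;
  sd_exp : int }.

Definition semidirect_pair (g : semidirect) := (sd_base g, sd_exp g).
Definition pair_semidirect (u : laurent * int) := SemiDirect u.1 u.2.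
Lemma semidirect_pairK : cancel semidirect_pair pair_semidirect.
Proof. by case. Qed.

HB.instance Definition _ := Choice.copy semidirect (can_type semidirect_pairK).

Definition sd_mul (g h : semidirect) : semidirect :=
  SemiDirect (sd_base g + laurentXz (sd_exp g) * sd_base h)
             (sd_exp g + sd_exp h).

Definition sd_one : semidirect := SemiDirect 0 0.

Definition sd_inv (g : semidirect) : semidirect :=
  SemiDirect (- (laurentXz (- sd_exp g) * sd_base g)) (- sd_exp g).

Lemma sd_mulA : associative sd_mul.
Proof.
case=> [p m] [q n] [r k]; congr SemiDirect; rewrite /= ?addrA //.
by rewrite laurentXzD mulrDr !mulrA addrA.
Qed.

Lemma sd_mul1g : left_id sd_one sd_mul.
Proof. by case=> p m; rewrite /sd_mul /= laurentXz0 mul1r !add0r. Qed.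

Lemma sd_mulg1 : right_id sd_one sd_mul.
Proof. by case=> p m; rewrite /sd_mul /= mulr0 !addr0. Qed.

Lemma sd_mulVg : left_inverse sd_one sd_inv sd_mul.
Proof. by case=> p m; rewrite /sd_mul /= !addNr. Qed.

Lemma sd_mulgV : right_inverse sd_one sd_inv sd_mul.
Proof.
by case=> p m; rewrite /sd_mul /= mulrN mulrA -laurentXzD !subrr laurentXz0
  mul1r subrr.
Qed.

HB.instance Definition _ := isGroup.Build semidirect
  sd_mulA sd_mul1g sd_mulg1 sd_mulVg sd_mulgV.

Definition sd_t : semidirect := SemiDirect 0 1.
Definition sd_incl (p : laurent) : semidirect := SemiDirect p 0.

Lemma sd_inclD p q : sd_incl (p + q) = (sd_incl p * sd_incl q)%g.
Proof. by congr SemiDirect; rewrite /= laurentXz0 mul1r. Qed.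

Lemma sd_tJ p : (sd_t * sd_incl p * sd_t^-1)%g = sd_incl (alpha p).
Proof. by congr SemiDirect; rewrite /= ?mulr0 ?oppr0 ?mulr0 ?addr0 ?add0r. Qed.

Definition monomials : set laurent :=
  [set p | exists n : nat, p = laurentXz n \/ p = - laurentXz n].

Fixpoint Qr (i r : nat) : set laurent :=
  if r is r'.+1 then
    Qr i r' `|`
      iter i alpha @` [set p + q | p in Qr i r' & q in Qr i r']
  else monomials.

Definition Q (i : nat) : set laurent := \bigcup_r Qr i r.

Definition Qt (i : nat) : set semidirect :=
  sd_incl @` Q i `|` [set sd_t; (sd_t^-1)%g].

(* Main.v *)
From mathcomp Require Import all_boot all_order all_algebra.
From mathcomp Require Import zify ring lra.
From mathcomp Require Import boolp classical_sets reals.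
Require Import Defs.

Set Implicit Arguments.
Unset Strict Implicit.
Unset Printing Implicit Defensive.

Import Order.TTheory GRing.Theory Num.Theory.

Local Open Scope classical_set_scope.
Local Open Scope ring_scope.

(** The base group Z[x, 1/x] is filled up by the dilates of a confining set Q:
multiplication by x maps Q into itself, every Laurent polynomial enters Q
after multiplication by a large power of x, and x^r (Q + Q) lies in Q.  The
proof shows that any proper confining set Q gives a quasi-parabolic Cayley
graph, and then that the sets Q i are proper, confining and pairwise far
apart.

Picture p t^m at height m.  Since t Q t^-1 lies in Q, every word can be
rewritten as t^-a q_1 ... q_k t^b without becoming longer
([word_normal_form]): first down, then across, then up.  Since a product of k
elements of Q lies in x^-(r s) Q as soon as k <= 2^s, a long horizontal piece
is traded for a descent of only logarithmic size.  Hence, up to a bounded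
error, the distance of g and h is

  horo_dist g h = 2 depth g h + height g + height h,

where - depth g h is the largest height, below those of g and h, at which an
element of Q joins the vertical lines through g and h.  Because
x^r (Q + Q) lies in Q, the depth is an ultrametric up to the additive constant
r ([depth_qultra]), and the four-point inequality for Gromov products follows
from this and symmetry ([horo_product_min]).

The sequences whose depth below the base point tends to infinity form one
boundary point.  It is fixed by the whole group, because translations change
the depth by a bounded amount.  It is the only one: if a sequence u is
equivalent to its translate by some q outside Q but its depth is small
infinitely often, then the depth of the pair u_n, q u_n is nonpositive for such
an n, and this says that q lies in Q ([sinks_of_translate]).  The element t is
loxodromic because the heights of its powers separate them.

To tell the Q i apart, choose 0 < lam < 1 with lam^j = 1/2.  Evaluation at lam
sends Q j into [-1, 1], since x^j (p + q) is sent to the mean of the values of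
p and q.  This shows that Q j is proper.  For i < j the element x^(i k) 2^k of
Q i has the value (2 lam^i)^k, which is unbounded in k, while boundedness of
Q i for the word norm of Qt j would put a single dilate x^A (Q i) inside
Q j. *)

(** * Word norms *)

Section WordNorm.
Variable G : groupType.
Implicit Types (S T : set G) (g h : G).

Lemma is_word0 S : is_word S 1%g 0.
Proof. by exists [::]; split=> //; rewrite big_nil. Qed.

Lemma is_word_cons S s g n : S s \/ S (s^-1)%g -> is_word S g n ->
  is_word S (s * g)%g n.+1.
Proof.
move=> Ss [w [<- wS ->]]; exists (s :: w); split=> //; last by rewrite big_cons.
by move=> s'; rewrite inE => /orP[/eqP ->|/wS].
Qed.

Lemma is_word_gen S s : S s -> is_word S s 1.
Proof.
by move=> Ss; rewrite -[s]mulg1; apply: is_word_cons (is_word0 S); left.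
Qed.

Lemma is_word_cat S g h m n : is_word S g m -> is_word S h n ->
  is_word S (g * h)%g (m + n).
Proof.
move=> [v [<- vS ->]] [w [<- wS ->]]; exists (v ++ w).
split; [by rewrite size_cat | | by rewrite big_cat].
by move=> s; rewrite mem_cat => /orP[/vS|/wS].
Qed.

Lemma is_word_exp S g n : S g \/ S (g^-1)%g -> is_word S (g ^+ n)%g n.
Proof.
move=> Sg; elim: n => [|n IH]; first exact: is_word0.
by rewrite expgS; apply: is_word_cons.
Qed.

Lemma is_word_ind S (P : G -> nat -> Prop) : P 1%g 0 ->
  (forall s g n, S s \/ S (s^-1)%g -> P g n -> P (s * g)%g n.+1) ->
  forall g n, is_word S g n -> P g n.
Proof.
move=> P0 PS g n [w [<- wS ->]] {g n}; elim: w wS => [|s w IH] wS.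
  by rewrite big_nil.
rewrite big_cons; apply: PS (wS s (mem_head _ _)) (IH _) => s' ws'.
by apply: wS; rewrite inE ws' orbT.
Qed.

Lemma word_norm_le S g n : is_word S g n -> (word_norm S g <= n)%N.
Proof.
move=> gn; rewrite /word_norm; case: pselect => // e.
by case: ex_minnP => k _; apply; apply/asboolP.
Qed.

Lemma word_normP S g : generates S -> is_word S g (word_norm S g).
Proof.
move=> genS; rewrite /word_norm; case: pselect => [e|[]].
  by case: ex_minnP => k /asboolP.
by have [n gn] := genS g; exists n; apply/asboolP.
Qed.

Lemma gen_le_refl S : gen_le S S.
Proof. by exists 1%N => g Sg; apply/word_norm_le/is_word_gen. Qed.

End WordNorm.

(** * Confining subsets *)

(** The confining subsets of Caprace, Cornulier, Monod and Tessera, for the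
automorphism [alpha] of the group of Laurent polynomials. *)
Record confining (r : nat) (Q : set laurent) : Prop := Confining {
  confiningN : forall p, Q p -> Q (- p);
  confining_alpha : forall p, Q p -> Q (alpha p);
  confiningD : forall p q, Q p -> Q q -> Q (laurentXz r * (p + q));
  confining_exhausts : forall p, exists n : nat, Q (laurentXz n * p) }.

Definition confining_gens (Q : set laurent) : set semidirect :=
  sd_incl @` Q `|` [set sd_t; (sd_t^-1)%g].

Lemma sd_mulE (g h : semidirect) : (g * h)%g =
  SemiDirect (sd_base g + laurentXz (sd_exp g) * sd_base h)
             (sd_exp g + sd_exp h).
Proof. by []. Qed.

Lemma sd_invE (g : semidirect) : (g^-1)%g =
  SemiDirect (- (laurentXz (- sd_exp g) * sd_base g)) (- sd_exp g).
Proof. by []. Qed.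

Lemma expgz_t (m : int) : expgz sd_t m = SemiDirect 0 m.
Proof.
have tn n : (sd_t ^+ n)%g = SemiDirect 0 n%:Z.
  elim: n => [//|n IH]; rewrite expgS IH sd_mulE /= mulr0 addr0.
  by congr SemiDirect; lia.
case: m => n; rewrite /expgz tn //.
by rewrite sd_invE /= mulr0 oppr0 NegzE.
Qed.

Lemma laurentXzK (m n : int) p : m + n = 0 ->
  laurentXz m * (laurentXz n * p) = p.
Proof. by move=> mn; rewrite mulrA -laurentXzD mn laurentXz0 mul1r. Qed.

Section Confining.
Variables (r : nat) (Q : set laurent).
Hypothesis confQ : confining r Q.
Local Notation S := (confining_gens Q).
Implicit Types (f g h o x y z : semidirect) (u v : nat -> semidirect).

Lemma confining0 : Q 0.
Proof. by have [n] := confining_exhausts confQ 0; rewrite mulr0. Qed.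

(** Absorption under [alpha] makes the exponents that bring [p] into [Q] an
upward closed set, which is what gives least exponents a meaning. *)
Lemma confining_shift (m n : int) p : m <= n ->
  Q (laurentXz m * p) -> Q (laurentXz n * p).
Proof.
move=> le_mn Qp; have -> : n = `|n - m|%N%:Z + m by lia.
elim: `|n - m|%N => [|k IH]; first by rewrite add0r.
have -> : k.+1%:Z + m = 1 + (k%:Z + m) by lia.
by rewrite laurentXzD -mulrA; apply: (confining_alpha confQ).
Qed.

(** Repeated halving of the list: each halving costs one factor x^r. *)
Lemma confining_sum (s : nat) (l : seq laurent) : (size l <= 2 ^ s)%N ->
  (forall q, q \in l -> Q q) ->
  Q (laurentXz (r * s)%N * \sum_(q <- l) q).
Proof.
elim: s l => [|s IH] l szl lQ.
  rewrite muln0 laurentXz0 mul1r; case: l szl lQ => [|q [|//]] _ lQ.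
    by rewrite big_nil; apply: confining0.
  by rewrite big_seq1; apply: lQ; rewrite inE.
rewrite -[l](cat_take_drop (2 ^ s)) big_cat /= mulnS PoszD laurentXzD -mulrA.
rewrite mulrDr; apply: (confiningD confQ); apply: IH.
- by rewrite size_take; case: ltnP.
- by move=> q /mem_take /lQ.
- by rewrite size_drop leq_subLR addnn -mul2n -expnS.
- by move=> q /mem_drop /lQ.
Qed.


Lemma is_word_t (m : int) : is_word S (SemiDirect 0 m) `|m|.
Proof.
have St : S sd_t by right; left.
have SV : S (sd_t^-1)%g by right; right.
rewrite -expgz_t; case: m => n; first by apply: is_word_exp; left.
by rewrite /expgz -expVgn; apply: is_word_exp; left.
Qed.

Lemma gens_cases s : S s \/ S (s^-1)%g ->
  [\/ exists2 q, Q q & s = sd_incl q, s = sd_t | s = (sd_t^-1)%g].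
Proof.
move=> [[[q Qq <-]|[->|->]]|[[q Qq sV]|[sV|sV]]].
- by apply: Or31; exists q.
- exact: Or32.
- exact: Or33.
- apply: Or31; exists (- q); first exact: (confiningN confQ).
  rewrite -[s]invgK -sV sd_invE /= oppr0 laurentXz0 mul1r.
  by congr SemiDirect.
- by apply: Or33; rewrite -sV invgK.
- by apply: Or32; rewrite -[s]invgK sV invgK.
Qed.

(** The relations q t^-1 = t^-1 (alpha q) and t q = (alpha q) t let the letters
t^-1 move to the left and the letters t to the right, where they cancel or pile
up; the letters from [Q] that they cross stay in [Q]. *)
Lemma word_normal_form g n : is_word S g n ->
  exists (a b : nat) (l : seq laurent),
    [/\ (a + size l + b <= n)%N, forall q, q \in l -> Q q,
        sd_exp g = b%:Z - a%:Z & laurentXz a * sd_base g = \sum_(q <- l) q].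
Proof.
elim/is_word_ind=> {g n} [|s g n sS [a [b [l [szl lQ expl sumE]]]]].
  by exists 0, 0, [::]; rewrite !big_nil /= mulr0.
case: (gens_cases sS) => [[q Qq ->]|->|->]; rewrite sd_mulE /=.
- exists a, b, (laurentXz a * q :: l); split=> /=; first by lia.
  + move=> q'; rewrite inE => /orP[/eqP ->|/lQ //].
    by apply: (@confining_shift 0) => //; rewrite laurentXz0 mul1r.
  + by rewrite expl add0r.
  + by rewrite big_cons laurentXz0 mul1r mulrDr sumE.
- case: a szl expl sumE => [|a] szl expl sumE.
    (* There is no t^-1 left to cancel t: it crosses the whole word. *)
    exists 0, b.+1, (map alpha l); split=> /=; first by rewrite size_map; lia.
    + by move=> _ /mapP[q /lQ Qq ->]; apply: (confining_alpha confQ).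
    + by rewrite expl; lia.
    + rewrite big_map /alpha -mulr_sumr -sumE laurentXz0 !mul1r add0r //.
  exists a, b, l; split=> //=; first by lia.
    by rewrite expl; lia.
  rewrite add0r mulrA -laurentXzD -sumE; congr (laurentXz _ * _); lia.
- exists a.+1, b, l; split=> //=; first by lia.
  rewrite mulr0 oppr0 add0r mulrA -laurentXzD -sumE.
  congr (laurentXz _ * _); lia.
Qed.

(** Spells g as t^-a q t^(a + height). *)
Lemma is_word_bridge g (a n : nat) :
  0 <= a%:Z + sd_exp g -> Q (laurentXz a * sd_base g) ->
  n%:Z = 2 * a%:Z + sd_exp g + 1 -> is_word S g n.
Proof.
move=> age0 Qg nE.
have -> : g = (SemiDirect 0 (- a%:Z)%R *
    (sd_incl (laurentXz a * sd_base g)%R * SemiDirect 0 (a%:Z + sd_exp g)%R))%g.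
  rewrite !sd_mulE /= !mulr0 addr0 add0r laurentXzK; last lia.
  by case: (g) => p m /=; congr SemiDirect; lia.
have -> : n = (`|(- a%:Z)%R| + (1 + `|(a%:Z + sd_exp g)%R|))%N by lia.
apply: is_word_cat (is_word_t _) (is_word_cat _ (is_word_t _)).
by apply: is_word_gen; left; exists (laurentXz a * sd_base g).
Qed.

Lemma confining_generates : generates S.
Proof.
move=> g; have [n Qn] := confining_exhausts confQ (sd_base g).
set a := (n + `|sd_exp g|)%N.
exists `|(2 * a%:Z + sd_exp g + 1)%R|%N.
apply: (@is_word_bridge _ a); try lia.
by apply: confining_shift Qn; lia.
Qed.

(** * The depth of a pair of points *)

(** At height [- k], below both points, one element of [Q] joins the vertical
lines through [g] and [h]. *)
Definition bridge (g h : semidirect) (k : int) : Prop :=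
  [/\ - sd_exp g <= k, - sd_exp h <= k &
      Q (laurentXz k * (sd_base h - sd_base g))].

Lemma bridge_le g h k k' : k <= k' -> bridge g h k -> bridge g h k'.
Proof.
move=> lek [gk hk Qk]; split; [exact: le_trans gk _|exact: le_trans hk _|].
exact: confining_shift Qk.
Qed.

Lemma depth_ex g h : exists c, forall k, bridge g h k <-> c <= k.
Proof.
have [n Qn] := confining_exhausts confQ (sd_base h - sd_base g).
have exP : exists k : nat, `[< bridge g h (k%:Z - sd_exp g) >].
  exists (n + `|sd_exp g| + `|sd_exp h|)%N; apply/asboolP; split; try lia.
  by apply: confining_shift Qn; lia.
case: (ex_minnP exP) => c0 /asboolP Bc min_c.
exists (c0%:Z - sd_exp g) => k; split=> [Bk|lek]; last exact: bridge_le Bc.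
have [gk _ _] := Bk; have : (c0 <= `|(k + sd_exp g)%R|)%N; last by lia.
by apply: min_c; apply/asboolP; apply: bridge_le Bk; lia.
Qed.

(** The least admissible [k], whose existence is [depth_ex]. *)
Definition depth g h : int :=
  xget 0 [set c | forall k, bridge g h k <-> c <= k].

Lemma depthP g h k : bridge g h k <-> depth g h <= k.
Proof.
rewrite /depth; case: xgetP => [c _ /(_ k) //|none].
by have [c /none] := depth_ex g h.
Qed.

Lemma depth_bridge g h : bridge g h (depth g h).
Proof. exact/depthP. Qed.

Lemma depth_sym g h : depth g h = depth h g.
Proof.
suff le g' h' : depth g' h' <= depth h' g' by apply/eqP; rewrite eq_le !le.
have [hk gk Qk] := depth_bridge h' g'; apply/depthP; split=> //.
by rewrite -opprB mulrN; apply: (confiningN confQ).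
Qed.

Lemma depth_ge g h : - sd_exp g <= depth g h.
Proof. by have [] := depth_bridge g h. Qed.

(** Two bridges at the same height compose to one lying [r] steps lower. *)
Lemma depth_qultra g h k : depth g k <= Num.max (depth g h) (depth h k) + r%:Z.
Proof.
set c := Num.max _ _.
have [gc hc Qgh] : bridge g h c by apply/depthP; rewrite le_max lexx.
have [_ kc Qhk] : bridge h k c by apply/depthP; rewrite le_max lexx orbT.
apply/depthP; split; try lia.
rewrite addrC laurentXzD -mulrA.
have -> : sd_base k - sd_base g =
    (sd_base h - sd_base g) + (sd_base k - sd_base h) by ring.
by rewrite mulrDr; apply: (confiningD confQ).
Qed.

(** Left translations preserve vertical lines and shift all heights by that of
[f]. *)
Lemma depth_mul f g h : depth (f * g)%g (f * h)%g = depth g h - sd_exp f.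
Proof.
have inv_le f' g' h' : depth (f' * g')%g (f' * h')%g <= depth g' h' - sd_exp f'.
  have [gk hk Qk] := depth_bridge g' h'.
  apply/depthP; split; rewrite ?sd_mulE /=; try lia.
  rewrite opprD addrACA subrr add0r -mulrBr mulrA -laurentXzD.
  by rewrite subrK.
apply/eqP; rewrite eq_le inv_le /=.
have := inv_le (f^-1)%g (f * g)%g (f * h)%g.
by rewrite !mulKg sd_invE /=; lia.
Qed.

(** The length of the path that goes down from [g] to the height of the bridge
and up again to [h], the crossing itself being neglected. *)
Definition horo_dist g h : int := 2 * depth g h + sd_exp g + sd_exp h.

Lemma horo_dist_mul f g h : horo_dist (f * g)%g (f * h)%g = horo_dist g h.
Proof. by rewrite /horo_dist depth_mul !sd_mulE /=; lia. Qed.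

Lemma word_norm_upper g : (word_norm S g)%:Z <= horo_dist 1%g g + 1.
Proof.
have [l0 lg Qg] := depth_bridge 1%g g; rewrite /= oppr0 in l0.
have [a aE] : exists a : nat, depth 1%g g = a by exists `|depth 1%g g|%N; lia.
have [n nE] : exists n : nat, n%:Z = 2 * a%:Z + sd_exp g + 1.
  by exists `|(2 * a%:Z + sd_exp g + 1)%R|%N; lia.
rewrite aE /= subr0 in lg Qg; have age0 : 0 <= a%:Z + sd_exp g by lia.
have := word_norm_le (is_word_bridge age0 Qg nE).
by rewrite /horo_dist aE /=; lia.
Qed.

(** A quantitative form of L log2 k <= k + O(1), with [s] playing the part of
log2 k; for L > 0, s = L + k / L works because 2^L > L and 2^(k / L) > k / L. *)
Lemma log_cover (L k : nat) :
  exists2 s, (k <= 2 ^ s)%N & (L * s <= k + L * L)%N.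
Proof.
case: L => [|L']; first by exists k; rewrite ?mul0n //; apply/ltnW/ltn_expl.
set L := L'.+1; exists (L + k %/ L)%N; last first.
  by rewrite mulnDr addnC leq_add2r mulnC leq_divM.
rewrite expnD; apply: (@leq_trans (L * (k %/ L).+1)).
  by rewrite mulnC; apply/ltnW/ltn_ceil.
by apply: leq_mul; [apply/ltnW/ltn_expl|apply: ltn_expl].
Qed.

(** In a normal form with [k] horizontal letters, replacing these by a descent
of [r * s] steps with [k <= 2 ^ s] lengthens the path by at most
[2 * r * s - k], which [log_cover] bounds. *)
Lemma word_norm_lower g :
  horo_dist 1%g g <= (word_norm S g)%:Z + ((2 * r) * (2 * r))%N%:Z.
Proof.
have [a [b [l [szl lQ expl sumE]]]] :=
  word_normal_form (word_normP g confining_generates).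
have [s szl2 les] := log_cover (2 * r) (size l).
have : depth 1%g g <= (a + r * s)%N%:Z.
  apply/depthP; split=> /=; try lia.
  rewrite subr0 addnC PoszD laurentXzD -mulrA sumE.
  exact: confining_sum.
by rewrite /horo_dist /=; nia.
Qed.


(** * Hyperbolicity *)

(** The Gromov product for [horo_dist]. *)
Definition horo_product o x y : int :=
  sd_exp o + depth o x + depth o y - depth x y.

(** The four-point condition for the ultrametric [depth] on o, x, y, z, with
its error [r] counted once for each of the two diagonals xz and oy. *)
Lemma horo_product_min o x y z :
  Num.min (horo_product o x y) (horo_product o y z) - (2 * r)%N%:Z <=
    horo_product o x z.
Proof.
rewrite /horo_product.
have := depth_qultra x y z; have := depth_qultra x o z.
have := depth_qultra o x y; have := depth_qultra o z y.
rewrite (depth_sym x o) (depth_sym z y); lia.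
Qed.

Section RealMetric.
Variable R : realType.
Local Notation d := (cayley_dist R S).

Definition approx_const : nat := ((2 * r) * (2 * r)).+1.

Lemma cayley_dist_approx x y :
  `|d x y - (horo_dist x y)%:~R| <= approx_const%:R.
Proof.
have := word_norm_upper (x^-1 * y)%g; have := word_norm_lower (x^-1 * y)%g.
have -> : horo_dist 1%g (x^-1 * y)%g = horo_dist x y.
  by rewrite -(mulVg x) horo_dist_mul.
rewrite /cayley_dist /approx_const; set k := word_norm _ _ => lo up.
rewrite !pmulrn -intrB -intr_norm ler_int; lia.
Qed.

Lemma gromov_product_approx o x y :
  `|gromov_product d o x y - (horo_product o x y)%:~R| <=
    (2 * approx_const)%N%:R.
Proof.
have := cayley_dist_approx x o; have := cayley_dist_approx y o.
have := cayley_dist_approx x y.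
have -> : horo_dist x y =
    horo_dist x o + horo_dist y o - 2 * horo_product o x y.
  by rewrite /horo_dist /horo_product (depth_sym x o) (depth_sym y o); lia.
rewrite /gromov_product natrM.
move: (d _ _) (d _ _) (d _ _) (horo_dist _ _) (horo_dist _ _) => a b c p q.
move: (horo_product _ _ _) (approx_const%:R) => h E.
by rewrite intrB intrD intrM !ler_norml; lra.
Qed.

Lemma cayley_hyperbolic : gromov_hyperbolic d.
Proof.
exists (4 * approx_const + 2 * r)%N%:R => o x y z.
have := gromov_product_approx o x y; have := gromov_product_approx o y z.
have := gromov_product_approx o x z.
have := horo_product_min o x y z.
rewrite !lerBlDr !ge_min natrD !natrM.
have le_intr a b : a <= b + (2 * r)%N%:Z -> a%:~R <= b%:~R + 2%:R * r%:R :> R.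
  by rewrite -(ler_int R) intrD -pmulrn natrM.
move: (gromov_product _ _ _ _) (gromov_product _ _ _ _) => a b.
move: (gromov_product _ _ _ _) => c; rewrite !ler_norml.
by move=> /orP[/le_intr|/le_intr] ? ? ? ?; apply/orP; [left|right]; lra.
Qed.

(** * The boundary *)

Lemma gromov_product_ge o x y (A : int) :
  A + (2 * approx_const)%N%:Z <= horo_product o x y ->
  A%:~R <= gromov_product d o x y.
Proof.
rewrite -(ler_int R) intrD -pmulrn.
have := gromov_product_approx o x y; rewrite ler_norml; lra.
Qed.

Lemma horo_product_ge o x y (A : int) :
  A%:~R <= gromov_product d o x y ->
  A - (2 * approx_const)%N%:Z <= horo_product o x y.
Proof.
rewrite -(ler_int R) intrB -pmulrn.
have := gromov_product_approx o x y; rewrite ler_norml; lra.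
Qed.

Lemma depth_basepoint o :
  exists K : int, forall x, depth 1%g x <= depth o x + K.
Proof.
exists (r%:Z + `|depth 1%g o| + `|sd_exp o|) => x.
by have := depth_qultra 1%g o x; have := depth_ge o x; lia.
Qed.

Lemma horo_product_basepoint o : exists K : int, forall x y,
  horo_product 1%g x y - K <= horo_product o x y.
Proof.
have [K le_K] := depth_basepoint o.
exists (2 * K - sd_exp o) => x y; rewrite /horo_product /=.
by have := le_K x; have := le_K y; lia.
Qed.

(** Divergence of Gromov products can be tested on the integer products at the
identity. *)
Lemma product_divergesP u v : product_diverges d u v <->
  forall A : int, exists N : nat, forall m n : nat,
    (N <= m)%N -> (N <= n)%N -> A <= horo_product 1%g (u m) (v n).
Proof.
split=> [uv A|uv o A].
  have [N leN] := uv 1%g (A + (2 * approx_const)%N%:Z)%:~R.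
  exists N => m n Nm Nn.
  by apply: le_trans (horo_product_ge (leN m n Nm Nn)); lia.
have [K leK] := horo_product_basepoint o.
have [B le_AB] : exists B : int, A <= B%:~R.
  by exists (Num.ceil A); exact: ceil_ge.
have [N leN] := uv (B + (2 * approx_const)%N%:Z + K).
exists N => m n Nm Nn; apply: le_trans le_AB (gromov_product_ge _).
by have := leN m n Nm Nn; have := leK (u m) (v n); lia.
Qed.

(** Membership of the boundary point that the group fixes. *)
Definition sinks (u : nat -> semidirect) : Prop :=
  forall A : int, exists N : nat, forall n, (N <= n)%N -> A <= depth 1%g (u n).

Lemma sinks_product u v : sinks u -> sinks v -> product_diverges d u v.
Proof.
move=> su sv; apply/product_divergesP => A.
have [M leM] := su (A + r%:Z); have [N leN] := sv (A + r%:Z).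
exists (maxn M N) => m n; rewrite !geq_max => /andP[Mm _] /andP[_ Nn].
have := depth_qultra (u m) 1%g (v n).
rewrite (depth_sym (u m) 1%g) /horo_product /=.
by have := leM m Mm; have := leN n Nn; lia.
Qed.

(** Quasi-ultrametricity: if the depth of [v n] were much smaller than that of
[u m], then the depth of the pair would be about that of [u m], and the product
about the depth of [v n]. *)
Lemma sinks_of_product u v : sinks u -> product_diverges d u v -> sinks v.
Proof.
move=> su /product_divergesP uv A.
have [M leM] := su (A + r%:Z); have [N leN] := uv (A + r%:Z).
exists N => n Nn; have := leN (maxn M N) n (leq_maxr _ _) Nn.
have := leM (maxn M N) (leq_maxl _ _).
have := depth_qultra 1%g (v n) (u (maxn M N)).
by rewrite (depth_sym (v n)) /horo_product /=; lia.
Qed.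

Lemma depth_mull g :
  exists K : int, forall x, depth 1%g (g * x)%g <= depth 1%g x + K.
Proof.
exists (`|depth 1%g (g^-1)%g| + r%:Z + `|sd_exp g| +
        `|depth (g^-1)%g 1%g|) => x.
have := depth_mul g (g^-1)%g x; rewrite mulgV => ->.
have := depth_qultra (g^-1)%g 1%g x.
by have := depth_ge 1%g x; rewrite /=; lia.
Qed.

Lemma sinks_mull g u : sinks u -> sinks (fun n => (g * u n)%g).
Proof.
move=> su A; have [K leK] := depth_mull (g^-1)%g.
have [N leN] := su (A + K); exists N => n Nn.
by have := leK (g * u n)%g; rewrite mulKg; have := leN n Nn; lia.
Qed.

(** If [u n] has depth less than [A], so has its translate up to a constant,
and the large product forces the depth of the pair below 0.  A bridge at height
0 between [u n] and its translate by [q] is an instance of [q] in [Q], since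
[q] acts on the base by adding it. *)
Lemma sinks_of_translate q u : ~ Q q ->
  product_diverges d u (fun n => (sd_incl q * u n)%g) -> sinks u.
Proof.
move=> nQq /product_divergesP du A; have [K leK] := depth_mull (sd_incl q).
have [N leN] := du (2 * A + K); exists N => n Nn.
have := leN n n Nn Nn; have := leK (u n); rewrite /horo_product /=.
rewrite leNgt => lev prod; apply/negP => ltA; apply: nQq.
have [_ _] : bridge (u n) (sd_incl q * u n)%g 0 by apply/depthP; lia.
by rewrite sd_mulE /= !laurentXz0 !mul1r addrK.
Qed.

(** The negative powers of t. *)
Definition descent (n : nat) : semidirect := SemiDirect 0 (- n%:Z).

Lemma sinks_descent : sinks descent.
Proof.
move=> A; exists `|A|%N => n An; have := depth_ge (descent n) 1%g.
by rewrite depth_sym /=; lia.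
Qed.

Lemma sinks_boundary : gromov_boundary d [set u | sinks u].
Proof.
exists descent; split; first exact: sinks_product sinks_descent sinks_descent.
apply/seteqP; split=> v /=.
  by move=> sv; split; apply: sinks_product => //; exact: sinks_descent.
by move=> [_]; apply: sinks_of_product sinks_descent.
Qed.

(** A fixed boundary point contains, with [u], the translate of [u] by [q], so
[sinks_of_translate] applies to it. *)
Lemma cayley_unique_fixed_point q : ~ Q q ->
  exists! xi : set (nat -> semidirect), gromov_boundary d xi /\
    forall g, boundary_act (fun g x => (g * x)%g) g xi = xi.
Proof.
move=> nQq; exists [set u | sinks u]; split.
  split=> [|g]; first exact: sinks_boundary.
  apply/seteqP; split=> [_ [u su <-]|u su]; first exact: sinks_mull.
  exists (fun n => g^-1 * u n)%g; first exact: sinks_mull.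
  by apply/funext => n /=; rewrite mulVKg.
move=> xi [[u [cu xiE]] fix_xi].
have su : sinks u.
  apply: (sinks_of_translate nQq).
  have : xi (fun n => (sd_incl q * u n)%g).
    by rewrite -(fix_xi (sd_incl q)); exists u => //; rewrite xiE.
  by rewrite xiE => -[].
rewrite xiE; apply/seteqP; split=> v /=.
  by move=> sv; split; exact: sinks_product.
by move=> [_]; apply: sinks_of_product.
Qed.

(** The powers of t lie on one vertical line, where [horo_dist] is the
difference of heights. *)
Lemma loxodromic_t : loxodromic d (fun g x => (g * x)%g) sd_t.
Proof.
exists 1%g, 1, approx_const%:R; split=> // m n.
have -> : int_dist R m n = (horo_dist (SemiDirect 0 m) (SemiDirect 0 n))%:~R.
  rewrite /int_dist -intr_norm; congr intmul.
  have := depth_ge (SemiDirect 0 m) (SemiDirect 0 n).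
  have := depth_ge (SemiDirect 0 n) (SemiDirect 0 m); rewrite depth_sym.
  have : depth (SemiDirect 0 m) (SemiDirect 0 n) <= Num.max (- m) (- n).
    apply/depthP; split=> /=; try lia.
    by rewrite subrr mulr0; apply: confining0.
  by rewrite /horo_dist /=; lia.
rewrite !mulg1 !expgz_t.
have := cayley_dist_approx (SemiDirect 0 m) (SemiDirect 0 n).
rewrite ler_norml divr1 mul1r; lra.
Qed.

Lemma confining_qp q : ~ Q q -> qp_structures R (gen_class S).
Proof.
move=> nQq; have genS := confining_generates; split.
  by exists S; split=> //; exact: cayley_hyperbolic.
exists S; split=> //; split; first exact: cayley_unique_fixed_point nQq.
by exists sd_t; exact: loxodromic_t.
Qed.

End RealMetric.
End Confining.

(** For an element of the base the norm is about twice its depth, so a bound on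
the norm is a bound on the exponent that brings it into [Q']. *)
Lemma gens_bounded_shift r r' (Q Q' : set laurent) :
  confining r Q -> confining r' Q' ->
  gen_le (confining_gens Q') (confining_gens Q) ->
  exists A : nat, forall q, Q q -> Q' (laurentXz A * q).
Proof.
move=> confQ confQ' [C leC]; exists (C + (2 * r') * (2 * r'))%N => q Qq.
have /leC leq : confining_gens Q (sd_incl q) by left; exists q.
have := word_norm_lower confQ' (sd_incl q); rewrite /horo_dist /= => low.
have lev0 := depth_ge confQ' 1%g (sd_incl q); rewrite /= in lev0.
have [_ _] : bridge Q' 1%g (sd_incl q) (C + (2 * r') * (2 * r'))%N%:Z.
  by apply/(depthP confQ'); lia.
by rewrite /= subr0.
Qed.

(** * Evaluation of Laurent polynomials *)

Lemma laurent_repr (f : laurent) :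
  exists pn : {poly int} * nat, laurent_val f = tofrac pn.1 / fracX ^+ pn.2.
Proof. by have /asboolP[p [n fE]] := laurent_valP f; exists (p, n). Qed.

Section Evaluation.
Variables (F : fieldType) (lam : F).
Hypothesis lam_neq0 : lam != 0.

Definition laurent_eval (f : laurent) : F :=
  let: (p, n) := projT1 (cid (laurent_repr f)) in
  (map_poly intr p).[lam] / lam ^+ n.

Lemma laurent_evalE f p n : laurent_val f = tofrac p / fracX ^+ n ->
  laurent_eval f = (map_poly intr p).[lam] / lam ^+ n.
Proof.
move=> fE; rewrite /laurent_eval; case: cid => -[q m] /= fE'.
have X0 k : fracX ^+ k != 0 by rewrite expf_neq0 ?fracX_neq0.
have l0 k : lam ^+ k != 0 by rewrite expf_neq0.
have /eqP := fE'; rewrite fE eqr_div ?X0 //.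
rewrite /fracX -!tofracXn -!tofracM tofrac_eq => /eqP pq.
apply/eqP; rewrite eqr_div ?l0 //; apply/eqP.
have /(congr1 (fun s => (map_poly intr s).[lam])) := pq.
by rewrite !rmorphM /= !map_polyXn !hornerM !hornerXn => ->.
Qed.

Lemma laurent_eval1 : laurent_eval 1 = 1.
Proof.
rewrite (@laurent_evalE 1 1 0); last by rewrite tofrac1 divr1.
by rewrite rmorph1 hornerC divr1.
Qed.

Lemma laurent_evalD : {morph laurent_eval : f g / f + g}.
Proof.
move=> f g; have [[p m] /= fE] := laurent_repr f.
have [[q n] /= gE] := laurent_repr g.
have X0 k : fracX ^+ k != 0 by rewrite expf_neq0 ?fracX_neq0.
have l0 k : lam ^+ k != 0 by rewrite expf_neq0.
rewrite (laurent_evalE fE) (laurent_evalE gE) addf_div ?l0 // -exprD.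
rewrite (@laurent_evalE _ (p * 'X^n + q * 'X^m) (m + n)).
  by rewrite rmorphD !rmorphM /= !map_polyXn hornerD !hornerM !hornerXn.
by rewrite /= fE gE addf_div ?X0 // exprD tofracD !tofracM !tofracXn.
Qed.

Lemma laurent_evalXz (n : nat) f :
  laurent_eval (laurentXz n * f) = lam ^+ n * laurent_eval f.
Proof.
have [[p m] /= fE] := laurent_repr f.
rewrite (laurent_evalE fE) (@laurent_evalE _ ('X^n * p) m).
  by rewrite rmorphM /= map_polyXn hornerM hornerXn mulrA.
by rewrite /= fE tofracM tofracXn mulrA.
Qed.

Lemma laurent_eval_nat n : laurent_eval n%:R = n%:R.
Proof.
elim: n => [|n IH].
  by apply: (addrI (laurent_eval 0)); rewrite -laurent_evalD !addr0.
by rewrite -natr1 laurent_evalD IH laurent_eval1 natr1.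
Qed.

Lemma laurent_evalN f : laurent_eval (- f) = - laurent_eval f.
Proof.
by apply/eqP; rewrite -addr_eq0 -laurent_evalD addNr (laurent_eval_nat 0).
Qed.

End Evaluation.

(** * The sets Q i are confining *)

Lemma iter_alpha n p : iter n alpha p = laurentXz n * p.
Proof.
elim: n => [|n IH]; first by rewrite laurentXz0 mul1r.
by rewrite iterS IH /alpha mulrA -laurentXzD.
Qed.

Lemma laurent_horner (p : {poly int}) :
  laurent_val (map_poly intr p).[laurentXz 1] = tofrac p.
Proof.
elim/poly_ind: p => [|p c IH]; first by rewrite rmorph0 horner0 tofrac0.
rewrite rmorphD rmorphM /= map_polyX map_polyC hornerMXaddC /= tofracD tofracM.
rewrite -IH; congr (_ + _).
have -> : c%:P = c%:~R :> {poly int} by rewrite -[in LHS](intz c) rmorph_int.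
rewrite rmorph_int.
exact: (rmorph_int (\val : {rmorphism laurent -> {fraction {poly int}}})).
Qed.

Section ConfiningQ.
Variable i : nat.

Lemma Qr_le m n : (m <= n)%N -> Qr i m `<=` Qr i n.
Proof.
move=> /subnK <-; elim: (n - m)%N => [//|k IH] p Qp.
by left; apply: IH.
Qed.

Lemma Q_ind (P : laurent -> Prop) :
  (forall n : nat, P (laurentXz n)) -> (forall n : nat, P (- laurentXz n)) ->
  (forall p q, P p -> P q -> P (laurentXz i * (p + q))) ->
  forall p, Q i p -> P p.
Proof.
move=> P1 P2 PD p [n _]; elim: n p => [|n IH] p /=.
  by move=> [n [->|->]].
move=> [/IH //|[_ [q Qq [s Qs <-]] <-]]; rewrite iter_alpha.
by apply: PD; apply: IH.
Qed.

Lemma QX (n : nat) : Q i (laurentXz n).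
Proof. by exists 0 => //; exists n; left. Qed.

Lemma QNX (n : nat) : Q i (- laurentXz n).
Proof. by exists 0 => //; exists n; right. Qed.

Lemma QD p q : Q i p -> Q i q -> Q i (laurentXz i * (p + q)).
Proof.
move=> [m _ Qp] [n _ Qq]; exists (maxn m n).+1 => //; right.
exists (p + q); last exact: iter_alpha.
exists p; first exact: Qr_le (leq_maxl _ _) _ Qp.
by exists q => //; exact: Qr_le (leq_maxr _ _) _ Qq.
Qed.

Lemma QN p : Q i p -> Q i (- p).
Proof.
elim/Q_ind=> {p} [n|n|p q Qp Qq]; [exact: QNX|by rewrite opprK; apply: QX|].
by rewrite -mulrN opprD; apply: QD.
Qed.

Lemma Q_alpha p : Q i p -> Q i (alpha p).
Proof.
elim/Q_ind=> {p} [n|n|p q Qp Qq]; rewrite /alpha.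
- by rewrite -laurentXzD; apply: (QX n.+1).
- by rewrite mulrN -laurentXzD; apply: (QNX n.+1).
- by rewrite mulrCA mulrDr; apply: QD.
Qed.

Lemma Q_shift (k : nat) p : Q i p -> Q i (laurentXz k * p).
Proof.
by move=> Qp; rewrite -iter_alpha; elim: k => //= k; apply: Q_alpha.
Qed.

(** The Laurent polynomials absorbed by [Q i] form a subgroup, stable under
multiplication by x and containing the monomials. *)
Lemma Q_exhausts f : exists n : nat, Q i (laurentXz n * f).
Proof.
pose E g := exists n : nat, Q i (laurentXz n * g).
have EX (n : nat) : E (laurentXz n).
  by exists 0; rewrite laurentXz0 mul1r; apply: QX.
have ED g h : E g -> E h -> E (g + h).
  move=> [m Qg] [n Qh]; exists (i + (m + n))%N.
  rewrite PoszD laurentXzD -mulrA mulrDr; apply: QD.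
    by rewrite addnC PoszD laurentXzD -mulrA; apply: Q_shift.
  by rewrite PoszD laurentXzD -mulrA; apply: Q_shift.
have EN g : E g -> E (- g).
  by move=> [n Qg]; exists n; rewrite mulrN; apply: QN.
have EXM g : E g -> E (laurentXz 1 * g).
  by move=> [n Qg]; exists n; rewrite mulrCA; apply: Q_shift.
have E0 : E 0 by rewrite -(subrr (laurentXz 0)); exact: ED (EX 0) (EN _ (EX 0)).
have Enat n : E n%:R.
  elim: n => [|n IH] //; rewrite -natr1; apply: ED => //.
  by rewrite -laurentXz0; exact: (EX 0).
have Eint (c : int) : E c%:~R.
  by case: c => n; rewrite ?NegzE ?mulrNz; [|apply: EN]; apply: Enat.
have Epoly (p : {poly int}) : E (map_poly intr p).[laurentXz 1].
  elim/poly_ind: p => [|p c IH]; first by rewrite rmorph0 horner0.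
  rewrite rmorphD rmorphM /= map_polyX map_polyC hornerMXaddC /=.
  by apply: ED => //; rewrite mulrC; apply: EXM.
have [[p n] /= fE] := laurent_repr f.
have [m Qm] := Epoly p; exists (m + n)%N; rewrite PoszD laurentXzD -mulrA.
suff -> : laurentXz n * f = (map_poly intr p).[laurentXz 1] by [].
apply: val_inj; rewrite /= laurent_horner fE mulrCA divff ?mulr1 //.
by rewrite expf_neq0 ?fracX_neq0.
Qed.

Lemma Q_confining : confining i (Q i).
Proof.
split; [exact: QN|exact: Q_alpha|exact: QD|exact: Q_exhausts].
Qed.

(** Doubling the monomial 1 at each of [k] stages. *)
Lemma Q_double (k : nat) : Q i (laurentXz (i * k)%N * (2 ^ k)%:R).
Proof.
elim: k => [|k IH]; first by rewrite muln0 mulr1; apply: QX.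
rewrite mulnS PoszD laurentXzD expnS natrM.
set y := laurentXz (i * k)%N; set c := (2 ^ k)%:R in IH *.
have -> : laurentXz i * y * (2%:R * c) = laurentXz i * (y * c + y * c) by ring.
exact: QD.
Qed.

End ConfiningQ.

(** * Evaluation at the root of 1/2 *)

Lemma half_root (R : rcfType) (j : nat) : (0 < j)%N ->
  exists lam : R, [/\ 0 < lam, lam < 1 & lam ^+ j = 2^-1].
Proof.
move=> j0; have [|lam] := @poly_ivt R ('X^j - (2^-1)%:P) 0 1 ler01.
  by rewrite !hornerE expr1n expr0n gtn_eqF //=; lra.
move=> /andP[l0 _]; rewrite rootE !hornerE subr_eq0.
move=> /eqP lamj; exists lam; split=> //.
  rewrite lt_neqAle l0 andbT; apply/eqP => lam0; move: lamj.
  by rewrite -lam0 expr0n gtn_eqF //=; lra.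
rewrite ltNge; apply/negP => /(exprn_ege1 j); rewrite lamj; lra.
Qed.

Section Separation.
Variables (R : realFieldType) (j : nat) (lam : R).
Hypotheses (lam_gt0 : 0 < lam) (lam_lt1 : lam < 1) (lamj : lam ^+ j = 2^-1).
Local Notation ev := (laurent_eval lam).

Let lam_neq0 : lam != 0. Proof. by rewrite gt_eqF. Qed.

Lemma evalX (n : nat) : ev (laurentXz n) = lam ^+ n.
Proof.
by rewrite -[laurentXz n]mulr1 laurent_evalXz // laurent_eval1 // mulr1.
Qed.

(** Since lam^j = 1/2, the new element x^j (p + q) evaluates to the mean of the
values of [p] and [q]. *)
Lemma Q_eval_le1 p : Q j p -> `|ev p| <= 1.
Proof.
have leX (n : nat) : `|ev (laurentXz n)| <= 1.
  by rewrite evalX ger0_norm ?exprn_ge0 ?exprn_ile1 // ltW.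
elim/Q_ind=> {p} [n|n|p q Qp Qq]; first exact: leX.
  by rewrite laurent_evalN // normrN; apply: leX.
rewrite laurent_evalXz // laurent_evalD // lamj normrM.
have := ler_normD (ev p) (ev q); rewrite ger0_norm; lra.
Qed.

Lemma Q_neqT : ~ Q j (laurentXz (-1)).
Proof.
move=> /Q_eval_le1.
have : lam * ev (laurentXz (-1)) = 1.
  rewrite -(laurent_evalXz lam_neq0 1) -laurentXzD.
  by rewrite subrr laurentXz0 laurent_eval1.
move=> lam_ev; rewrite ler_norml => /andP[_ /(ler_wpM2l (ltW lam_gt0))].
by rewrite lam_ev mulr1 leNgt lam_lt1.
Qed.

(** Evaluated at lam, x^A x^(i k) 2^k would have to be at most 1 for all k.  For
k = j (A + 1) its value is lam^A 2^((j - i) (A + 1)), at least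
2^-A 2^(A + 1) = 2. *)
Lemma Qt_not_bounded i : (i < j)%N -> ~ gen_le (Qt j) (Qt i).
Proof.
move=> ij /(gens_bounded_shift (Q_confining i) (Q_confining j))[A QA].
have /Q_eval_le1 := QA _ (Q_double i (j * A.+1)).
rewrite !laurent_evalXz // laurent_eval_nat // mulnCA exprM lamj.
apply/negP; rewrite -ltNge.
have halfK n : 2^-1 ^+ n * 2 ^+ n = 1 :> R.
  by rewrite -exprMn mulVf ?expr1n // pnatr_eq0.
have lamA : 2^-1 ^+ A <= lam ^+ A.
  rewrite -lamj -exprM ler_wiXn2l ?ltW //.
  by rewrite leq_pmull //; apply: leq_ltn_trans ij.
set m := ((j - i.+1) * A.+1)%N.
have -> : (j * A.+1)%N = (i * A.+1 + (A + m.+1))%N by rewrite /m; nia.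
rewrite natrX !exprD (mulrA (2^-1 ^+ _)) halfK mul1r ger0_norm.
  apply: lt_le_trans (ler_wpM2r _ lamA); last by rewrite mulr_ge0 // exprn_ge0.
  by rewrite mulrA halfK mul1r exprn_egt1 // ltr1n.
by rewrite !mulr_ge0 // exprn_ge0 // ltW.
Qed.

End Separation.

Theorem proposition5p2 (R : realType) :
  (forall i j : nat, (0 < i)%N -> (i < j)%N ->
     gen_class (Qt i) <> gen_class (Qt j)) /\
  (forall i : nat, (0 < i)%N -> qp_structures R (gen_class (Qt i))).
Proof.
split=> [i j i0 ij eq_class|i i0].
  have [lam [lam_gt0 lam_lt1 lamj]] := half_root R (leq_ltn_trans (leq0n i) ij).
  have : gen_class (Qt i) (Qt i).
    have genS := confining_generates (Q_confining i).
    by split=> //; exact: gen_le_refl.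
  by rewrite eq_class => -[_ _ /(Qt_not_bounded lam_gt0 lam_lt1 lamj ij)].
have [lam [lam_gt0 lam_lt1 lami]] := half_root R i0.
exact: (confining_qp (Q_confining i) R (Q_neqT lam_gt0 lam_lt1 lami)).
Qed.
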